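(* Let $(X,T)$ be a Cantor aperiodic system with a basic set $Y$. Then the subgroup $\Gamma_Y$ is $\tau_0$-dense in the full group $[T]=[T]_C$ if and only if the basic set $Y$ is at most countable.
   Context: A Cantor aperiodic system $(X,T)$ is a Cantor set $X$ with a homeomorphism $T:X\to X$ that is aperiodic: $T^nx\ne x$ for all $x\in X$ and all integers $n\neq0$. A Borel set $Y\subset X$ is wandering if $T^nY\cap Y=\emptyset$ for all $n\ge1$. A basic set is a closed wandering set $Y$ such that every clopen neighborhood of $Y$ meets every $T$-orbit. Topology $\tau_0$: on the group $Homeo(X)$ of all homeomorphisms of $X$, $\tau_0$ is the topology with base the sets $\{S\in Homeo(X):\mu_i(\{x: Sx\ne Rx\})<\varepsilon,\ i=1,\ldots,n\}$, where $R\in Homeo(X)$, $\varepsilon>0$ and $\mu_1,\ldots,\mu_n$ are continuous (i.e. non-atomic) Borel probability measures on $X$. Full groups: with $Orb_T(x)=\{T^nx:n\in\mathbb Z\}$, $[T]_C=\{S\in Homeo(X): Orb_S(x)\subseteq Orb_T(x)\text{ for all }x\in X\}$. For $S\in[T]_C$ let $n_S:X\to\mathbb Z$ be the function with $Sx=T^{n_S(x)}x$ (unique since $T$ is aperiodic); $[[T]]=\{S\in[T]_C: n_S\text{ is continuous}\}$. Kakutani–Rokhlin partitions: a $T$-tower is a family $\xi=\{A,TA,\ldots,T^{n-1}A\}$ of disjoint sets; $A=B(\xi)$ is its base and $n=h(\xi)$ its height. A clopen Kakutani–Rokhlin (K-R) partition is a (finite) partition of $X$ into clopen sets (atoms) which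 is the union of finitely many $T$-towers; its base is the union of the bases of its towers. Fix a sequence $\{\mathcal P_n\}_{n\ge1}$ of clopen K-R partitions of $X$ such that for all $n\ge 1$: (i) $\mathcal P_{n+1}$ refines $\mathcal P_n$; (ii) $h_{n+1}>h_n$, where $h_n$ is the height of the lowest $T$-tower in $\mathcal P_n$; (iii) $B(\mathcal P_n)\supset B(\mathcal P_{n+1})$; (iv) the sequence $\{\mathcal P_n\}$ generates the clopen topology of $X$; (v) $\bigcap_n B(\mathcal P_n)=Y$. (Such a sequence exists.) The subgroup $\Gamma_Y$ of $[[T]]$: $S\in[[T]]$ belongs to $\Gamma_Y$ if there is $n$ such that no level of $\mathcal P_n$ goes over the top or through the bottom of its tower under $S$, i.e. for every tower $\{D,TD,\ldots,T^{h-1}D\}$ of $\mathcal P_n$ and every $0\le j\le h-1$ there is an integer $l$ with $0\le l+j\le h-1$ such that $Sx=T^lx$ for all $x\in T^jD$. Thus $S$ acts as a permutation of the levels of each $T$-tower of $\mathcal P_n$, and $\Gamma_Y$ is an increasing union of permutation groups. *)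

(* Defs.v *)
From HB Require Import structures.
From mathcomp Require Import all_boot all_order all_algebra.
From mathcomp Require Import all_classical all_reals all_analysis.

Set Implicit Arguments.
Unset Strict Implicit.
Unset Printing Implicit Defensive.

Import Order.TTheory GRing.Theory Num.Theory.
Local Open Scope classical_set_scope.
Local Open Scope ring_scope.

Record homeo (X : topologicalType) := Homeo {
  hfun :> X -> X;
  hinv : X -> X;
  hfunK : cancel hfun hinv;
  hinvK : cancel hinv hfun;
  hfun_continuous : continuous hfun;
  hinv_continuous : continuous hinv }.

HB.instance Definition _ (X : topologicalType) := gen_eqMixin (homeo X).
HB.instance Definition _ (X : topologicalType) := gen_choiceMixin (homeo X).

(* [Negz k] is the integer -(k+1). *)
Definition iterz (X : topologicalType) (T : homeo X) (n : int) : X -> X :=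
  match n with
  | Posz k => iter k T
  | Negz k => iter k.+1 (hinv T)
  end.

Definition homeo_orbit (X : topologicalType) (T : homeo X) (x : X) : set X :=
  [set iterz T n x | n in [set: int]].

Definition aperiodic (X : topologicalType) (T : homeo X) : Prop :=
  forall (x : X) (n : int), n != 0 -> iterz T n x <> x.

Definition wandering (X : topologicalType) (T : homeo X) (Y : set X) : Prop :=
  forall n : nat, (0 < n)%N -> (iter n T @` Y) `&` Y = set0.

Definition basic_set (X : topologicalType) (T : homeo X) (Y : set X) : Prop :=
  [/\ closed Y,
      wandering T Y &
      forall U : set X, clopen U -> Y `<=` U ->
        forall x : X, U `&` homeo_orbit T x !=set0].

Definition borel (X : ptopologicalType) := g_sigma_algebraType (@open X).

Definition continuous_measure (R : realType) (X : ptopologicalType)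
    (mu : probability (borel X) R) : Prop :=
  forall x : X, mu [set x] = 0%E.

Definition tau0_ball (R : realType) (X : ptopologicalType) (S0 : homeo X)
    (n : nat) (mu : 'I_n -> probability (borel X) R) (e : R) : set (homeo X) :=
  [set S | forall i : 'I_n, (mu i [set x : X | S x <> S0 x] < e%:E)%E].

Definition tau0_base (R : realType) (X : ptopologicalType) :
    set (set (homeo X)) :=
  [set B | exists (S0 : homeo X) (n : nat)
             (mu : 'I_n -> probability (borel X) R) (e : R),
     [/\ forall i, continuous_measure (mu i), 0 < e & B = tau0_ball S0 mu e]].
Arguments tau0_base R X : clear implicits.

(* Homeo(X) with the topology generated by [tau0_base]. That this family is a
   base, and not only a subbase, needs the sets {x | S x <> S' x} to be Borel,
   hence X Hausdorff: see [tau0_basis]. *)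
Definition tau0 (R : realType) (X : ptopologicalType) : Type := homeo X.

HB.instance Definition _ (R : realType) (X : ptopologicalType) :=
  Choice.on (tau0 R X).
HB.instance Definition _ (R : realType) (X : ptopologicalType) :=
  isSubBaseTopological.Build (tau0 R X) (tau0_base R X) id.

Definition full_group (X : topologicalType) (T : homeo X) : set (homeo X) :=
  [set S | forall x : X, homeo_orbit S x `<=` homeo_orbit T x].

(* When T is aperiodic, [n] is unique. *)
Definition topological_full_group (X : topologicalType) (T : homeo X) :
    set (homeo X) :=
  [set S | full_group T S /\
     exists n : X -> discrete_topology int,
       (forall x, S x = iterz T (n x) x) /\ continuous n].

Record tower_family (X : Type) := TowerFamily {
  ntowers : nat;
  tbase : 'I_ntowers -> set X;
  theight : 'I_ntowers -> nat }.

Definition level_index (X : Type) (P : tower_family X) :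
    set ('I_(ntowers P) * nat) :=
  [set p | (p.2 < theight p.1)%N].
Arguments level_index {X} P.

Definition level (X : topologicalType) (T : homeo X) (P : tower_family X)
    (p : 'I_(ntowers P) * nat) : set X :=
  iter p.2 T @` tbase p.1.
Arguments level {X} T P p.

Definition atoms (X : topologicalType) (T : homeo X) (P : tower_family X) :
    set (set X) :=
  [set level T P p | p in level_index P].

Definition KR_partition (X : topologicalType) (T : homeo X)
    (P : tower_family X) : Prop :=
  [/\ forall i : 'I_(ntowers P), (0 < theight i)%N,
      partition (level_index P) (level T P) [set: X] &
      forall A, atoms T P A -> clopen A].

Definition KR_base (X : Type) (P : tower_family X) : set X :=
  \bigcup_i @tbase X P i.

(* [minn] has no neutral element: the maximal height is the default. *)
Definition lowest_height (X : Type) (P : tower_family X) : nat :=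
  \big[minn/(\max_(i < ntowers P) theight i)%N]_(i < ntowers P) theight i.

Definition refines (X : topologicalType) (T : homeo X)
    (P' P : tower_family X) : Prop :=
  forall A', atoms T P' A' -> exists2 A, atoms T P A & A' `<=` A.

(* The index runs over nat from 0, instead of n >= 1. *)
Definition KR_sequence (X : topologicalType) (T : homeo X) (Y : set X)
    (P : nat -> tower_family X) : Prop :=
  (forall n, KR_partition T (P n)) /\
  [/\ forall n, refines T (P n.+1) (P n),
      forall n, (lowest_height (P n) < lowest_height (P n.+1))%N,
      forall n, KR_base (P n.+1) `<=` KR_base (P n),
      basis (\bigcup_n atoms T (P n)) &
      \bigcap_n KR_base (P n) = Y].

Definition Gamma (X : topologicalType) (T : homeo X)
    (P : nat -> tower_family X) : set (homeo X) :=
  [set S | topological_full_group T S /\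
     exists n : nat, forall (i : 'I_(ntowers (P n))) (j : nat),
       (j < theight i)%N ->
       exists l : int, 0 <= l + j%:Z <= (theight i)%:Z - 1 /\
         forall x, level T (P n) (i, j) x -> S x = iterz T l x].

Section tau0_basis.
Variables (R : realType) (X : ptopologicalType).
Hypothesis hX : hausdorff_space X.

Lemma open_homeo_neq (S S' : homeo X) : open [set x : X | S x <> S' x].
Proof.
rewrite openE => x /= /eqP nSS'.
have := hX; rewrite open_hausdorff => /(_ _ _ nSS').
move=> [[A B] /= [AS BS'] [oA oB /eqP AB0]].
have nA : \forall y \near x, A (S y).
  by apply: (@hfun_continuous _ S x); apply: open_nbhs_nbhs; split;
    [exact: oA|exact: set_mem].
have nB : \forall y \near x, B (S' y).
  by apply: (@hfun_continuous _ S' x); apply: open_nbhs_nbhs; split;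
    [exact: oB|exact: set_mem].
near=> y => SS'.
suff : (A `&` B) (S y) by rewrite AB0.
by split; [near: y|rewrite SS'; near: y].
Unshelve. all: by end_near. Qed.

Lemma measurable_homeo_neq (S S' : homeo X) :
  measurable ([set x | S x <> S' x] : set (borel X)).
Proof. by apply: sub_sigma_algebra; exact: open_homeo_neq. Qed.

Lemma tau0_ball_center (S0 S : homeo X) (n : nat)
    (mu : 'I_n -> probability (borel X) R) (e : R) :
  tau0_ball S0 mu e S ->
  exists2 d : R, 0 < d & tau0_ball S mu d `<=` tau0_ball S0 mu e.
Proof.
move=> SS0.
pose m i := fine (mu i [set x : X | S x <> S0 x]).
have mE i : mu i [set x : X | S x <> S0 x] = (m i)%:E.
  by rewrite fineK// fin_num_measure//; exact: measurable_homeo_neq.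
exists (\big[Order.min/1]_(i < n) (e - m i)).
  apply: lt_bigmin => // i _.
  by rewrite subr_gt0 -lte_fin -mE; exact: SS0.
move=> S' SS' i.
have le_d : \big[Order.min/1]_(i < n) (e - m i) <= e - m i by exact: bigmin_le.
have mS := measurable_homeo_neq S S0; have mS' := measurable_homeo_neq S' S.
apply: (@le_lt_trans _ _ (mu i ([set x : X | S' x <> S x] `|`
    [set x : X | S x <> S0 x]))).
  apply: le_measure; rewrite ?inE//.
  - exact: measurable_homeo_neq.
  - exact: measurableU.
  - move=> x /= S'S0; have [<-|] := pselect (S' x = S x); by [right|left].
apply: (@le_lt_trans _ _ (mu i [set x : X | S' x <> S x] +
    mu i [set x : X | S x <> S0 x])%E); first exact: measureU2.
rewrite mE -lteBrDr//; apply: lt_le_trans (SS' i) _.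
by rewrite -EFinB lee_fin.
Qed.

Lemma tau0_ball_setI (S : homeo X) (n1 n2 : nat)
    (mu1 : 'I_n1 -> probability (borel X) R)
    (mu2 : 'I_n2 -> probability (borel X) R) (d1 d2 : R) :
  (forall i, continuous_measure (mu1 i)) ->
  (forall i, continuous_measure (mu2 i)) -> 0 < d1 -> 0 < d2 ->
  exists B, [/\ tau0_base R X B, B S &
    B `<=` tau0_ball S mu1 d1 `&` tau0_ball S mu2 d2].
Proof.
move=> mu1_cont mu2_cont d1_gt0 d2_gt0.
pose mu (i : 'I_(n1 + n2)) :=
  match fintype.split i with inl i1 => mu1 i1 | inr i2 => mu2 i2 end.
have d_gt0 : 0 < Order.min d1 d2 by rewrite lt_min d1_gt0.
exists (tau0_ball S mu (Order.min d1 d2)); split.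
- exists S, (n1 + n2)%N, mu, (Order.min d1 d2); split=> // i.
  by rewrite /mu; case: fintype.split.
- move=> i; rewrite (_ : mkset _ = set0) ?measure0 ?lte_fin//.
  by apply/seteqP; split.
- move=> S' SS'; split=> i.
  + have := SS' (lshift n2 i); rewrite /mu -[lshift n2 i]/(unsplit (inl i)).
    rewrite unsplitK => /lt_le_trans; apply.
    by rewrite lee_fin ge_min lexx.
  + have := SS' (rshift n1 i); rewrite /mu -[rshift n1 i]/(unsplit (inr i)).
    rewrite unsplitK => /lt_le_trans; apply.
    by rewrite lee_fin ge_min lexx orbT.
Qed.

Lemma tau0_base_setI (S : homeo X) (B1 B2 : set (homeo X)) :
  tau0_base R X B1 -> tau0_base R X B2 -> B1 S -> B2 S ->
  exists B, [/\ tau0_base R X B, B S & B `<=` B1 `&` B2].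
Proof.
move=> [S1 [n1 [mu1 [e1 [mu1_cont _ ->]]]]] [S2 [n2 [mu2 [e2 [mu2_cont _ ->]]]]].
move=> /tau0_ball_center [d1 d1_gt0 sub1] /tau0_ball_center [d2 d2_gt0 sub2].
have [B [baseB BS subB]] := tau0_ball_setI S mu1_cont mu2_cont d1_gt0 d2_gt0.
by exists B; split=> // S' /subB [/sub1 ? /sub2 ?].
Qed.

Lemma tau0_base_cover (S : homeo X) : exists2 B, tau0_base R X B & B S.
Proof.
pose mu0 (i : 'I_0) : probability (borel X) R := False_rect _ (notF (ltn_ord i)).
exists (tau0_ball S mu0 1); last by case.
by exists S, 0%N, mu0, 1; split=> // -[].
Qed.

Lemma tau0_base_finI (S : homeo X) (C : set (homeo X)) :
  finI_from (tau0_base R X) id C -> C S ->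
  exists B, [/\ tau0_base R X B, B S & B `<=` C].
Proof.
move=> [F Fbase <-] FS.
suff: forall s : seq (set (homeo X)),
    (forall C', C' \in s -> tau0_base R X C' /\ C' S) ->
    exists B, [/\ tau0_base R X B, B S & forall C', C' \in s -> B `<=` C'].
  move=> /(_ (finmap.enum_fset F))[C' C'F|B [baseB BS subB]].
    by split; [apply/set_mem/Fbase|exact: FS].
  by exists B; split=> // S' BS' C' C'F; exact: subB C'F _ BS'.
elim=> [_|C' s IHs sS].
  by have [B] := tau0_base_cover S; exists B.
have [C'' C''s|B [baseB BS subB]] := IHs.
  by apply: sS; rewrite inE C''s orbT.
have [baseC' C'S] := sS C' (mem_head _ _).
have [B' [baseB' B'S subB']] := tau0_base_setI baseB baseC' BS C'S.
exists B'; split=> // C''; rewrite inE => /orP[/eqP ->|C''s] S' /subB'[]//.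
by move=> BS' _; exact: subB C''s _ BS'.
Qed.

Lemma tau0_basis : basis (tau0_base R X : set (set (tau0 R X))).
Proof.
split=> [B baseB|S A].
  exists [set B]; last by rewrite bigcup_set1.
  by move=> _ ->; exact: (@finI_from1 _ _ (tau0_base R X) id).
rewrite nbhsE => -[_ [[D' D'sub <-] [C D'C CS]] subA].
have [B [baseB BS subB]] := tau0_base_finI (D'sub _ D'C) CS.
by exists B => // S' BS'; apply: subA; exists C => //; exact: subB.
Qed.

End tau0_basis.

(* Main.v *)
Require Import Defs.
From HB Require Import structures.
From mathcomp Require Import all_boot all_order all_algebra.
From mathcomp Require Import all_classical all_reals all_analysis.
From mathcomp Require Import fingroup perm zify lra.

(** Let [S] be in the full group of [T] and let [E k] be the closed set of the
    points that [S] moves by [T ^ k]; as [T] is aperiodic, these sets partition the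
    space, and so do their images under [S].

    Suppose that [Y] is countable. Given finitely many non-atomic measures, the
    points outside the union of the [E k] with [|k| <= K] have small measure for
    [K] large ([far_set_small]). The points whose orbit meets the base of [P n]
    within time [K] decrease, as [n] grows, to a set of translates of [Y], which
    is countable and hence null, so they too have small measure for [n] large
    ([near_base_small]). By compactness ([KR_sequence_separates]) every atom of
    [P n], for [n] large, meets at most one [E k] and at most one [S (E k)] with
    [|k| <= K]. Moving by [k] the levels that meet [E k] is then a partial
    injection of the levels of each tower of [P n]; any extension to a
    permutation gives an element of the group of [P n] that agrees with [S] off
    the two small sets ([tower_homeo_approx], [Gamma_dense_at]).

    Conversely, a point of [Y] lies in the base of every [P n], so an element of
    [Gamma] can only move it by a nonnegative power of [T]: it differs from the
    inverse of [T] at every point of [Y] ([Gamma_neq_inv]). If [Y] is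
    uncountable, it carries a non-atomic probability measure
    ([exists_continuous_measure]), and the inverse of [T] is not in the closure
    of [Gamma]. The measure is the image of the uniform measure under an
    injective measurable map from the reals to [Y]: a real number is coded by
    the sequence of bits telling which rationals lie below it, and the bits
    select a branch in a binary tree of clopen sets, all of which meet [Y] in
    uncountably many points. *)

Set Implicit Arguments.
Unset Strict Implicit.
Unset Printing Implicit Defensive.

Import Order.TTheory GRing.Theory Num.Theory.
Local Open Scope classical_set_scope.
Local Open Scope ring_scope.

(** * Iterates and the full group *)

Section Iterates.
Context {X : topologicalType}.
Implicit Types (S T : homeo X) (m n k : int) (x : X).

Lemma iterz_succ T n x : iterz T (n + 1) x = T (iterz T n x).
Proof.
case: n => [k|[|k]].
- by rewrite -[Posz k + 1]PoszD addn1.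
- by rewrite /= hinvK.
- rewrite (_ : Negz k.+1 + 1 = Negz k); last lia.
  by rewrite [in RHS]/iterz iterS hinvK.
Qed.

Lemma iterz_pred T n x : iterz T (n - 1) x = hinv T (iterz T n x).
Proof. by rewrite -[in RHS](subrK 1 n) iterz_succ hfunK. Qed.

Lemma iterzD T m n x : iterz T (m + n) x = iterz T m (iterz T n x).
Proof.
elim/int_ind: m => [|k IH|k IH]; first by rewrite add0r.
- by rewrite -addn1 PoszD addrAC !iterz_succ IH.
- rewrite (_ : - k.+1%:Z = - k%:Z - 1); last lia.
  by rewrite addrAC !iterz_pred IH.
Qed.

Lemma iterzK T n : cancel (iterz T n) (iterz T (- n)).
Proof. by move=> x; rewrite -iterzD addNr. Qed.

Lemma iterzVK T n : cancel (iterz T (- n)) (iterz T n).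
Proof. by move=> x; rewrite -iterzD subrr. Qed.

Lemma iterz_continuous T n : continuous (iterz T n).
Proof.
elim/int_ind: n => [|k IH|k IH] x.
- exact: cvg_id.
- have -> : iterz T k.+1 = T \o iterz T k by [].
  by apply: continuous_comp; [exact: IH|exact: hfun_continuous].
- have -> : iterz T (- k.+1%:Z) = hinv T \o iterz T (- k%:Z).
    apply/funext => y; rewrite (_ : - k.+1%:Z = - k%:Z - 1); last lia.
    exact: iterz_pred.
  by apply: continuous_comp; [exact: IH|exact: hinv_continuous].
Qed.

(** The power [T ^ n] as a homeomorphism. *)
Definition homeo_iterz T n : homeo X :=
  Homeo (@iterzK T n) (@iterzVK T n) (@iterz_continuous T n)
    (@iterz_continuous T (- n)).

(** The inverse homeomorphism. *)
Definition homeo_inv S : homeo X :=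
  Homeo (@hinvK _ S) (@hfunK _ S) (@hinv_continuous _ S) (@hfun_continuous _ S).

Lemma aperiodic_inj T : aperiodic T ->
  forall m n x, iterz T m x = iterz T n x -> m = n.
Proof.
move=> aperT m n x mn; apply/eqP; rewrite -subr_eq0; apply: contraT => mn0.
by have := aperT x _ mn0; rewrite addrC iterzD mn iterzK.
Qed.

(** It is enough to know where [S] itself sends each point, and not its
    iterates. *)
Lemma full_groupP T S :
  full_group T S <-> forall x, exists n, S x = iterz T n x.
Proof.
split=> [ST x|ST x _ [n _ <-]].
  by have [|n _ <-] := ST x (S x); [exists 1 | exists n].
elim/int_ind: n => [|k [l _ kl]|k [l _ kl]]; first by exists 0.
- have [m mE] := ST (iterz S k x); exists (m + l) => //.
  by rewrite iterzD kl -mE.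
- rewrite (_ : - k.+1%:Z = - k%:Z - 1); last lia.
  rewrite iterz_pred -kl; have [m] := ST (hinv S (iterz T l x)).
  rewrite hinvK => mE; exists (- m + l) => //.
  by rewrite iterzD [in LHS]mE iterzK.
Qed.

Lemma full_group_inv T : full_group T (homeo_inv T).
Proof. by apply/full_groupP => x; exists (-1). Qed.

End Iterates.

(** * Permutations of the levels of towers *)

(** A partial injection of a finite set extends to a permutation, because the
    complements of its domain and of its range have as many elements. *)
Lemma perm_extend (I : finType) (D : {set I}) (f : I -> I) :
  {in D &, injective f} -> exists s : {perm I}, {in D, forall x, s x = f x}.
Proof.
move=> injf; pose E := enum (~: D)%SET; pose F := enum (~: (f @: D))%SET.
have EF : size E = size F.
  rewrite -!cardE [LHS]cardsCs [RHS]cardsCs !finset.setCK.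
  by rewrite (card_in_imset injf).
pose g x := if x \in D then f x else nth x F (index x E).
have memE x : x \notin D -> (index x E < size F)%N.
  by move=> xD; rewrite -EF index_mem mem_enum finset.in_setC.
have gF x : x \notin D -> g x \notin (f @: D)%SET.
  move=> xD; rewrite /g (negbTE xD).
  by have := mem_nth x (memE _ xD); rewrite mem_enum finset.in_setC.
have gD x : x \in D -> g x \in (f @: D)%SET.
  by move=> xD; rewrite /g xD; exact: imset_f.
have injg : injective g.
  move=> x y; have [xD|xD] := boolP (x \in D); have [yD|yD] := boolP (y \in D).
  - by rewrite /g xD yD; exact: injf.
  - by move=> gxy; have := gF _ yD; rewrite -gxy gD.
  - by move=> gxy; have := gF _ xD; rewrite gxy gD.
  - rewrite /g (negbTE xD) (negbTE yD) (set_nth_default x y (memE _ yD)).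
    move=> /eqP; rewrite (nth_uniq _ (memE _ xD) (memE _ yD) (enum_uniq _)).
    by move=> /eqP /(index_inj x); apply; rewrite mem_enum finset.in_setC.
by exists (perm injg) => x xD; rewrite permE /g xD.
Qed.

Section Towers.
Context {X : topologicalType} (T : homeo X) (Q : tower_family X).
Hypothesis KRQ : KR_partition T Q.

Let level := level T Q.

Lemma level_iterz i (j j' : nat) (k : int) x :
  level (i, j) x -> j'%:Z = k + j%:Z -> level (i, j') (iterz T k x).
Proof.
move=> [b bi <-] j'E; exists b => //=.
by rewrite -[iter j T b]/(iterz T j b) -iterzD -j'E.
Qed.

Lemma level_uniq i j i' j' x : (j < theight i)%N -> (j' < theight i')%N ->
  level (i, j) x -> level (i', j') x -> (i, j) = (i', j').
Proof. by case: KRQ => _ [_ triv _] _ ? ? ? ?; apply: triv => //; exists x. Qed.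

Lemma level_clopen i j : (j < theight i)%N -> clopen (level (i, j)).
Proof. by case: KRQ => _ _ clo ji; apply: clo; exists (i, j). Qed.

Lemma level_ex x : exists i j, (j < theight i)%N /\ level (i, j) x.
Proof.
case: KRQ => _ [cov _ _] _; have : [set: X] x by [].
by rewrite -cov => -[[i j] ji xij]; exists i, j.
Qed.

Lemma level0_base i x : level (i, 0%N) x -> KR_base Q x.
Proof. by move=> [b bi <-]; exists i. Qed.

(** The image under [T] of the top of a tower lies in the base. *)
Lemma level_top_base i x : level (i, (theight i).-1) x -> KR_base Q (T x).
Proof.
case: (KRQ) => h0 _ _; have hi := h0 i; move=> xtop.
have [i' [[|j'] [ji xij]]] := level_ex (T x); first exact: level0_base xij.
have xj' : level (i', j') x.
  rewrite -(hfunK T x) -[hinv T _]/(iterz T (-1) _); apply: level_iterz xij _.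
  lia.
have := level_uniq _ (ltnW ji) xtop xj'; rewrite ltn_predL => /(_ hi)[ii' jj'].
by move: ji; rewrite -jj' -ii'; lia.
Qed.

(** If [k] steps move the level of [x] out of its tower, then the orbit of [x]
    meets the base within [|k|] steps. *)
Lemma level_out_base i j (k : int) x : (j < theight i)%N -> level (i, j) x ->
  ~~ (0 <= j%:Z + k < (theight i)%:Z) ->
  exists m : int, (`|m| <= `|k|)%N /\ KR_base Q (iterz T m x).
Proof.
move=> ji xij out; have [jk|jk] := ltP (j%:Z + k) 0.
  exists (- j%:Z); split; first lia.
  by apply: (@level0_base i); apply: level_iterz xij _; lia.
exists ((theight i - j)%N%:Z); split; first lia.
rewrite (_ : Posz _ = ((theight i).-1 - j)%N%:Z + 1); last lia.
rewrite iterz_succ; apply: (@level_top_base i); apply: level_iterz xij _; lia.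
Qed.

(** The positions of the levels: a tower of height [h], and a number in
    [0, ..., h - 1]. *)
Definition level_pos := {i : 'I_(ntowers Q) & 'I_(theight i)}.

Lemma level_pos_ex x :
  exists u : level_pos, level (tag u, tagged u : nat) x.
Proof.
have [i [j [ji xij]]] := level_ex x.
by exists (Tagged (fun i => 'I_(theight i)) (Ordinal ji)).
Qed.

(** The position of the level that contains [x]. *)
Definition pos_of x : level_pos := projT1 (cid (level_pos_ex x)).

Lemma pos_ofP x : level (tag (pos_of x), tagged (pos_of x) : nat) x.
Proof. exact: (projT2 (cid (level_pos_ex x))). Qed.

Lemma pos_ofE (u : level_pos) x :
  level (tag u, tagged u : nat) x -> pos_of x = u.
Proof.
move: (pos_of x) (pos_ofP x) => [i j] /= xij; case: u => i' j' /= xij'.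
have [ii' jj'] := level_uniq (ltn_ord j) (ltn_ord j') xij xij'.
case: _ / ii' in j' jj' xij' *.
by congr existT; exact: val_inj.
Qed.

Lemma near_pos_of x : \forall y \near x, pos_of y = pos_of x.
Proof.
have /level_clopen[oL _] := ltn_ord (tagged (pos_of x)).
have := open_nbhs_nbhs (conj oL (pos_ofP x)).
by apply: filterS => y; exact: pos_ofE.
Qed.

(** Applying a permutation of the levels of each tower, by powers of [T]. *)
Section TowerPerm.
Variable s : forall i : 'I_(ntowers Q), {perm 'I_(theight i)}.

(** The position to which [s] sends [u]. *)
Definition pos_perm (u : level_pos) : level_pos :=
  Tagged (fun i => 'I_(theight i)) (s (tag u) (tagged u)).

(** The power of [T] that leads from the level at [u] to the one at
    [pos_perm u]. *)
Definition pos_shift (u : level_pos) : int :=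
  (tagged (pos_perm u))%:Z - (tagged u)%:Z.

(** The map that moves each level onto its image under [s]. *)
Definition tower_perm x := iterz T (pos_shift (pos_of x)) x.

Lemma pos_of_tower_perm x : pos_of (tower_perm x) = pos_perm (pos_of x).
Proof.
apply: pos_ofE; apply: level_iterz (pos_ofP x) _.
by rewrite /pos_shift subrK.
Qed.

Lemma tower_perm_continuous : continuous tower_perm.
Proof.
move=> x; apply: (@cvg_trans _ (iterz T (pos_shift (pos_of x)) @ x)).
  apply: near_eq_cvg; near do rewrite /tower_perm.
  by near=> y; rewrite (near (near_pos_of x) y).
exact: iterz_continuous.
Unshelve. all: by end_near. Qed.

Lemma pos_shift_continuous :
  continuous (pos_shift \o pos_of : X -> discrete_topology int).
Proof.
move=> x A /= /(@nbhs_singleton (discrete_topology int)) Ax.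
by apply: filterS (near_pos_of x) => y /= ->.
Qed.

End TowerPerm.

Lemma tower_permK s : cancel (tower_perm s) (tower_perm (fun i => (s i)^-1%g)).
Proof.
move=> x; rewrite {1}/tower_perm pos_of_tower_perm -iterzD /pos_shift /=.
by rewrite permK addrA subrK subrr.
Qed.

Lemma tower_permVK s : cancel (tower_perm (fun i => (s i)^-1%g)) (tower_perm s).
Proof.
move=> x; rewrite {1}/tower_perm pos_of_tower_perm -iterzD /pos_shift /=.
by rewrite permKV addrA subrK subrr.
Qed.

(** The homeomorphism that permutes the levels of the towers by [s]. *)
Definition tower_homeo s : homeo X :=
  Homeo (tower_permK s) (tower_permVK s) (@tower_perm_continuous s)
    (@tower_perm_continuous _).

End Towers.

Lemma tower_homeo_Gamma (X : topologicalType) (T : homeo X)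
    (P : nat -> tower_family X) n (KRn : KR_partition T (P n)) s :
  Gamma T P (tower_homeo KRn s).
Proof.
split.
  split; first by apply/full_groupP => x; exists (pos_shift s (pos_of KRn x)).
  exists (pos_shift s \o pos_of KRn); split=> //.
  exact: pos_shift_continuous.
exists n => i j ji.
pose u : level_pos (P n) := Tagged (fun i => 'I_(theight i)) (Ordinal ji).
exists (pos_shift s u); split=> [|x xij].
  rewrite /pos_shift /= subrK; have := ltn_ord (s i (Ordinal ji)); lia.
by rewrite /= /tower_perm (pos_ofE KRn (u := u)).
Qed.

(** If each level meets at most one of the sets [{x | S x = T^k x}] and at most
    one of their images under [S], [k] between [-K] and [K], then shifting by [k]
    the levels that meet the [k]-th set is a partial injection of the levels of
    each tower, and any permutation extending it agrees with [S] up to points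
    where [S] moves further than [K], or whose orbit meets the base within time
    [K]. *)
Lemma tower_homeo_approx (X : topologicalType) (T S : homeo X)
    (Q : tower_family X) (KRQ : KR_partition T Q) (K : nat)
    (sep : forall p (k k' : int) x x', level_index Q p ->
      (`|k| <= K)%N -> (`|k'| <= K)%N -> level T Q p x -> level T Q p x' ->
      S x = iterz T k x -> S x' = iterz T k' x' -> k = k')
    (sepS : forall p (k k' : int) x x', level_index Q p ->
      (`|k| <= K)%N -> (`|k'| <= K)%N -> level T Q p (S x) ->
      level T Q p (S x') ->
      S x = iterz T k x -> S x' = iterz T k' x' -> k = k') :
  exists s, forall x, tower_homeo KRQ s x <> S x ->
    (forall k : int, (`|k| <= K)%N -> S x <> iterz T k x) \/
    (exists k : int, (`|k| <= K)%N /\ KR_base Q (iterz T k x)).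
Proof.
(* The level at height [j] of tower [i] meets [{x | S x = T^k x}], and [j'] is
   where this power of [T] sends it, if it stays in the tower. *)
pose moves (i : 'I_(ntowers Q)) (j j' : 'I_(theight i)) (k : int) :=
  [/\ (`|k| <= K)%N, j'%:Z = j%:Z + k :> int &
    exists2 x, level T Q (i, j : nat) x & S x = iterz T k x].
have movesr i (j j1 j2 : 'I_(theight i)) k1 k2 :
    moves i j j1 k1 -> moves i j j2 k2 -> j1 = j2.
  move=> [Kk1 j1E [x1 xj1 Sx1]] [Kk2 j2E [x2 xj2 Sx2]]; apply/val_inj.
  have k12 := sep (i, j : nat) _ _ _ _ (ltn_ord j) Kk1 Kk2 xj1 xj2 Sx1 Sx2.
  by apply/eqP; rewrite -eqz_nat j1E k12 j2E.
have movesl i (j1 j2 j : 'I_(theight i)) k1 k2 :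
    moves i j1 j k1 -> moves i j2 j k2 -> j1 = j2.
  move=> [Kk1 j1E [x1 xj1 Sx1]] [Kk2 j2E [x2 xj2 Sx2]]; apply/val_inj.
  have lS k x (j' : 'I_(theight i)) : level T Q (i, j' : nat) x ->
      j%:Z = j'%:Z + k -> S x = iterz T k x -> level T Q (i, j : nat) (S x).
    by move=> xj' jE ->; apply: level_iterz xj' _; rewrite addrC.
  have k12 := sepS (i, j : nat) _ _ _ _ (ltn_ord j) Kk1 Kk2 (lS _ _ _ xj1 j1E Sx1)
    (lS _ _ _ xj2 j2E Sx2) Sx1 Sx2.
  apply/eqP; rewrite -eqz_nat; apply/eqP/(addIr k1).
  by rewrite -j1E k12.
have exs (i : 'I_(ntowers Q)) : exists s : {perm 'I_(theight i)},
    forall j j' k, moves i j j' k -> s j = j'.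
  pose D := [set j | `[< exists j' k, moves i j j' k >]]%SET.
  pose f j := if pselect (exists j' k, moves i j j' k) is left e
    then projT1 (cid e) else j.
  have fD j : j \in D -> exists k, moves i j (f j) k.
    rewrite finset.inE => /asboolP ex; rewrite /f; case: pselect => // e.
    exact: (projT2 (cid e)).
  have injf : {in D &, injective f}.
    by move=> j1 j2 /fD[k1 m1] /fD[k2 +] f12; rewrite -f12; exact: movesl m1.
  have [s sf] := perm_extend injf; exists s => j j' k m.
  have jD : j \in D by rewrite finset.inE; apply/asboolP; exists j', k.
  by have [k' m'] := fD _ jD; rewrite sf//; exact: movesr m' m.
pose s i := projT1 (cid (exs i)); have sE i := projT2 (cid (exs i)).
exists s => x neq; apply: contrapT => /not_orP[/existsNP[k /not_implyP[Kk]]].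
move=> /contrapT Sx nbase; apply: neq.
have := pos_ofP KRQ x; move posx : (pos_of KRQ x) => [i j] /= xij.
have [jk|out] := boolP (0 <= j%:Z + k < (theight i)%:Z); last first.
  have [m [mk mbase]] := level_out_base KRQ (ltn_ord j) xij out.
  by exfalso; apply: nbase; exists m; split=> //; exact: leq_trans mk Kk.
have j'i : (`|(j%:Z + k)%R| < theight i)%N by lia.
have mv : moves i j (Ordinal j'i) k.
  by split=> //=; [lia|exists x].
rewrite /tower_perm posx /pos_shift /= (sE _ _ _ _ mv : s i j = _) Sx /=.
by congr (iterz _ _ _); lia.
Qed.

(** * Binary codes of real numbers *)

(** The [n]-th bit of [t] tells whether the [n]-th rational is below [t]; it
    is [false] if [n] codes no rational. These bits determine [t], and each of
    them is constant on two half-lines, hence measurable. *)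
Definition cut_bit (R : realType) (n : nat) (t : R) : bool :=
  if @unpickle rat n is Some q then ratr q < t else false.

Lemma cut_bit_inj (R : realType) (t t' : R) :
  (forall n, cut_bit n t = cut_bit n t') -> t = t'.
Proof.
have sep (u v : R) : u < v -> exists n, cut_bit n u != cut_bit n v.
  move=> /rat_in_itvoo[q]; rewrite in_itv /= => /andP[uq qv].
  by exists (pickle q); rewrite /cut_bit pickleK qv ltNge (ltW uq).
move=> tt'; apply/eqP; case: ltgtP => // /sep[n]; by rewrite tt' eqxx.
Qed.

Lemma measurable_cut_bit (R : realType) n (b : bool) :
  measurable [set t : measurableTypeR R | cut_bit n t = b].
Proof.
suff mT : measurable [set t : measurableTypeR R | cut_bit n t].
  case: b => //; rewrite [X in measurable X](_ : _ = ~` [set t | cut_bit n t]).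
    exact: measurableC.
  by apply/seteqP; split=> t /=; case: cut_bit.
rewrite /cut_bit; case: unpickle => [q|].
  rewrite (_ : mkset _ = [set` `]ratr q, +oo[]); first exact: measurable_itv.
  by apply/seteqP; split=> t /=; rewrite in_itv /= andbT.
by rewrite (_ : mkset _ = set0) //; apply/seteqP; split.
Qed.

(** * A non-atomic probability measure on an uncountable closed set *)

Section UncountableClosed.
Context {X : ptopologicalType} (B : set (set X)) (Y : set X).
Hypotheses (hX : hausdorff_space X) (cptX : compact [set: X]).
Hypotheses (cB : countable B) (basisB : basis B) (clB : B `<=` clopen).
Hypotheses (clY : closed Y) (ucY : ~ countable Y).

Lemma basis_sub x (V : set X) : nbhs x V -> exists A, [/\ B A, A x & A `<=` V].
Proof. by move=> /(basisB.2 x)[A [BA Ax] AV]; exists A. Qed.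

Lemma clopen_base_enum : exists e : nat -> set X, (forall n, clopen (e n)) /\
  forall x V, nbhs x V -> exists n, e n x /\ e n `<=` V.
Proof.
have /countable_injP[f injf] := cB.
(* The [n]-th set of the base, or the empty set if no set has the code [n]. *)
pose F n := [set A | B A /\ f A = n].
have FE A : B A -> \bigcup_(A' in F (f A)) A' = A.
  move=> BA; apply/seteqP; split=> [x [A' [BA' AA'] A'x]|x Ax].
    by rewrite -(injf _ _ (mem_set BA') (mem_set BA) AA').
  by exists A.
exists (fun n => \bigcup_(A in F n) A); split=> [n|x V /basis_sub[A [BA Ax AV]]].
  have [[A [BA <-]]|F0] := pselect (exists A, F n A).
    by rewrite FE//; exact: clB.
  rewrite (_ : \bigcup_(A in _) A = set0).
    by split; [exact: open0|exact: closed0].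
  by apply/seteqP; split=> // x [A FA _]; apply: F0; exists A.
by exists (f A); rewrite FE.
Qed.

(** The clopen sets that [Y] meets in uncountably many points. *)
Definition large (U : set X) := clopen U /\ ~ countable (U `&` Y).

(** All points of [U] and [Y] outside the countable set [N] are condensation
    points: [N] collects the sets of the base that meet [U] and [Y] in countably
    many points. *)
Lemma large_condensation U : large U -> exists N, countable N /\
  forall x V, U x -> Y x -> ~ N x -> clopen V -> V x -> large (U `&` V).
Proof.
move=> [clU ucU].
pose F := [set A | B A /\ countable (A `&` (U `&` Y))].
exists (\bigcup_(A in F) (A `&` (U `&` Y))); split.
  apply: bigcup_countable => [|A []//].
  by apply: sub_countable cB; apply: subset_card_le => A [].
move=> x V Ux Yx Nx clV Vx; split.
  exact: clopenI.
move=> cUV; have /basis_sub[A [BA Ax AV]] := open_nbhs_nbhs (conj clV.1 Vx).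
apply: Nx; exists A => //; split=> //; apply: sub_countable cUV.
by apply: subset_card_le => z [/AV Vz [Uz Yz]].
Qed.

(** A large set contains two disjoint large sets, neither of which is cut by a
    given clopen set. *)
Lemma large_split e U : clopen e -> large U -> exists C : bool -> set X,
  [/\ forall b, large (C b) /\ C b `<=` U,
      forall b, C b `<=` e \/ C b `<=` ~` e & C true `&` C false = set0].
Proof.
move=> cle lU; have [N [cN condN]] := large_condensation lU.
have [x [[Ux Yx] Nx] [y [[Uy Yy] Ny xy]]] : exists2 x, (U `&` Y `\` N) x &
    exists y, [/\ (U `&` Y) y, ~ N y & x != y].
  apply: contrapT => noxy; case: (lU) => _; apply.
  have [[x [UYx Nx]]|none] := pselect (exists x, (U `&` Y `\` N) x).
    pose D (b : bool) := if b then N else [set x].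
    have cD : countable (\bigcup_b D b).
      by apply: bigcup_countable => // -[] _ //=; exact: countable1.
    apply: sub_countable cD; apply: subset_card_le => y UYy.
    have [->|yx] := eqVneq y x; first by exists false.
    exists true => //; apply: contrapT => Ny; apply: noxy; exists x => //.
    by exists y; split=> //; rewrite eq_sym.
  apply: sub_countable cN; apply: subset_card_le => y UYy.
  by apply: contrapT => Ny; apply: none; exists y.
have [V [clV Vx Vy]] : exists V, [/\ clopen V, V x & ~ V y].
  have := hX; rewrite open_hausdorff => /(_ _ _ xy)[[P Q] /=].
  move=> [/set_mem Px /set_mem Qy] [oP oQ /eqP PQ0].
  have [A [BA Ax AP]] := basis_sub (open_nbhs_nbhs (conj oP Px)).
  exists A; split=> //; first exact: clB.
  by move=> /AP Py; rewrite -[False]/(set0 y) -PQ0.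
have pick z : exists E, [/\ clopen E, E z & E `<=` e \/ E `<=` ~` e].
  have [ez|nez] := pselect (e z); first by exists e; split=> //; left.
  by exists (~` e); split=> //; [exact: clopenC|right].
have [Ex [clEx Exx Exe]] := pick x; have [Ey [clEy Eyy Eye]] := pick y.
exists (fun b => U `&` (if b then V `&` Ex else ~` V `&` Ey)); split.
- case; (split; last by move=> ? []).
  + by apply: (condN x) => //; apply: clopenI.
  + by apply: (condN y) => //; apply: clopenI => //; exact: clopenC.
- case; [case: Exe => sub|case: Eye => sub];
    by [left=> z [_ [_ /sub]]|right=> z [_ [_ /sub]]].
- by apply/seteqP; split=> z // [[_ [Vz _]] [_ [nVz _]]].
Qed.

Context {R : realType}.
Variable e : nat -> set X.
Hypotheses (cle : forall n, clopen (e n))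
  (base_e : forall x V, nbhs x V -> exists n, e n x /\ e n `<=` V).

(** The two pieces into which a large set is split at step [n]; the default for
    sets that are not large is never used. *)
Definition halves n (U : set X) : bool -> set X :=
  if pselect (large U) is left lU then projT1 (cid (large_split (cle n) lU))
  else fun=> U.

Lemma halvesP n U : large U ->
  [/\ forall b, large (halves n U b) /\ halves n U b `<=` U,
      forall b, halves n U b `<=` e n \/ halves n U b `<=` ~` (e n) &
      halves n U true `&` halves n U false = set0].
Proof.
move=> lU; rewrite /halves; case: pselect => // l.
exact: (projT2 (cid (large_split (cle n) l))).
Qed.

(** The branch of the binary tree of large sets that follows the bits of [t]. *)
Fixpoint branch (t : R) n : set X :=
  if n is m.+1 then halves m (branch t m) (cut_bit m t) else setT.

Lemma branch_large t n : large (branch t n).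
Proof.
elim: n => [|n IH] /=; last by have [/(_ (cut_bit n t))[]] := halvesP n IH.
by split; [split; [exact: openT|exact: closedT]|rewrite setTI].
Qed.

Lemma branch_sub t n : branch t n.+1 `<=` branch t n.
Proof.
by have [/(_ (cut_bit n t))[]] := halvesP n (branch_large t n).
Qed.

Lemma branch_small t n : branch t n.+1 `<=` e n \/ branch t n.+1 `<=` ~` (e n).
Proof. by have [_ + _] := halvesP n (branch_large t n); exact. Qed.

Lemma branch_ex t : exists x, forall n, branch t n x /\ Y x.
Proof.
have /choice[y yP] n : exists x, (branch t n `&` Y) x.
  apply: contrapT => none; case: (branch_large t n) => _; apply.
  rewrite (_ : _ `&` _ = set0)//; apply/seteqP; split=> // x xP.
  by apply: none; exists x.
have [x [_ xcl]] : [set: X] `&` cluster (y @ \oo) !=set0.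
  by apply: cptX; exact: filterT.
exists x => n; split; last first.
  apply: clY; move: xcl; rewrite clusterE; apply.
  by exists 0%N => // k _; exact: (yP k).2.
apply: (branch_large t n).1.2; move: xcl; rewrite clusterE; apply.
exists n => // k /= nk; suff : branch t k `<=` branch t n.
  by apply; exact: (yP k).1.
rewrite -(subnKC nk); elim: (k - n)%N => [|m IH]; first by rewrite addn0.
by rewrite addnS; apply: subset_trans IH; exact: branch_sub.
Qed.

(** A point of [Y] in all the sets of the branch of [t]: there is only one, as
    every set [e n] of the base is decided along the branch. *)
Definition branch_point (t : measurableTypeR R) : borel X :=
  projT1 (cid (branch_ex t)).

Lemma branch_pointP t n : branch t n (branch_point t).
Proof. exact: (projT2 (cid (branch_ex t)) n).1. Qed.

Lemma branch_point_in t : Y (branch_point t).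
Proof. exact: (projT2 (cid (branch_ex t)) 0%N).2. Qed.

Lemma branch_point_inj : injective branch_point.
Proof.
move=> t t' tt'; have sub n : branch t n = branch t' n -> cut_bit n t = cut_bit n t'.
  move=> bE; have := branch_pointP t n.+1; have := branch_pointP t' n.+1.
  rewrite tt' /= bE.
  have [_ _ disj] := halvesP n (branch_large t' n).
  set z := branch_point t'; case: (cut_bit n t); case: (cut_bit n t') => // h h'.
    by exfalso; rewrite -[False]/(set0 z) -disj.
  by exfalso; rewrite -[False]/(set0 z) -disj.
have bE n : branch t n = branch t' n.
  by elim: n => //= n IH; rewrite (sub _ IH) IH.
by apply: cut_bit_inj => n; exact/sub/bE.
Qed.

Lemma measurable_branch n (S : set (set X)) :
  measurable [set t : measurableTypeR R | S (branch t n)].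
Proof.
elim: n S => [|n IH] S /=.
  have [ST|nST] := pselect (S setT).
    by rewrite (_ : mkset _ = setT)//; apply/seteqP; split.
  by rewrite (_ : mkset _ = set0)//; apply/seteqP; split.
rewrite (_ : mkset _ =
    ([set t | S (halves n (branch t n) true)] `&` [set t | cut_bit n t = true]) `|`
    ([set t | S (halves n (branch t n) false)] `&` [set t | cut_bit n t = false])).
  by apply: measurableU; apply: measurableI;
    [exact: (IH [set U | S (halves n U true)])|exact: measurable_cut_bit|
     exact: (IH [set U | S (halves n U false)])|exact: measurable_cut_bit].
apply/seteqP; split=> t /=.
  by case: (cut_bit n t) => St; [left|right].
by move=> [[St ->]|[St ->]].
Qed.

Lemma measurable_branch_point : measurable_fun setT branch_point.
Proof.
apply: (@measurability _ _ _ (borel X) setT branch_point (@open X) erefl).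
move=> _ [V oV <-]; rewrite setTI.
rewrite (_ : _ @^-1` V =
    \bigcup_n [set t : measurableTypeR R | branch t n `<=` V]).
  by apply: bigcupT_measurable => n; exact: (measurable_branch n [set U | U `<=` V]).
apply/seteqP; split=> [t Vt|t [n _ sub]]; last by apply: sub; exact: branch_pointP.
have [n [en enV]] := base_e (open_nbhs_nbhs (conj oV Vt)).
exists n.+1 => //=; case: (branch_small t n) => sub.
  exact: subset_trans sub enV.
by have := sub _ (branch_pointP t n.+1).
Qed.

End UncountableClosed.

(** The measure is the image of the uniform measure on the unit interval under
    the injective map [branch_point]. *)
Lemma exists_continuous_measure (R : realType) (X : ptopologicalType)
    (B : set (set X)) (Y : set X) :
  hausdorff_space X -> compact [set: X] ->
  countable B -> basis B -> B `<=` clopen ->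
  closed Y -> ~ countable Y ->
  exists mu : probability (borel X) R, continuous_measure mu /\ mu Y = 1%E.
Proof.
move=> hX cptX cB basisB clB clY ucY.
have [e [cle base_e]] := clopen_base_enum cB basisB clB.
pose h := branch_point hX cptX cB basisB clB clY ucY (R := R) cle.
have mh : measurable_fun setT h by exact: measurable_branch_point.
have injh : injective h by exact: branch_point_inj.
pose hM : {mfun measurableTypeR R >-> borel X} :=
  HB.pack h (isMeasurableFun.Build _ _ _ _ _ mh).
exists (distribution (uniform_prob (@ltr01 R)) hM); split=> [x|].
  rewrite /distribution /pushforward /=.
  have [[t ht]|none] := pselect (exists t, h t = x); last first.
    rewrite (_ : _ @^-1` _ = set0) ?measure0//.
    by apply/seteqP; split=> // t ht; apply: none; exists t.
  rewrite (_ : _ @^-1` _ = [set t]).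
    have /null_content_dominatesP := @dominates_uniform_prob R 0 1 ltr01.
    by apply; [exact: measurable_set1|exact: lebesgue_measure_set1].
  apply/seteqP; split=> [t' ht'|t' ->//].
  by apply: injh; rewrite ht -ht'.
rewrite /distribution /pushforward /=.
rewrite (_ : _ @^-1` _ = setT) ?probability_setT//.
by apply/seteqP; split=> // t _; exact: branch_point_in.
Qed.

(** * Sequences of Kakutani-Rokhlin partitions *)

Section KRSequence.
Context {X : topologicalType} (T : homeo X) (Y : set X).
Variable P : nat -> tower_family X.
Hypothesis seqP : KR_sequence T Y P.

Lemma KR_sequence_partition n : KR_partition T (P n).
Proof. by case: seqP. Qed.

Lemma KR_sequence_base_open n : open (KR_base (P n)).
Proof.
apply: bigcup_open => i _; have [h0 _ _] := KR_sequence_partition n.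
have [+ _] := level_clopen (KR_sequence_partition n) (h0 i).
by rewrite /level /= image_id.
Qed.

Lemma KR_sequence_base_le m n : (m <= n)%N -> KR_base (P n) `<=` KR_base (P m).
Proof.
move=> mn; rewrite -(subnKC mn); elim: (n - m)%N => [|k IH].
  by rewrite addn0.
by rewrite addnS; apply: subset_trans IH; case: seqP => _ [_ _ + _ _]; exact.
Qed.

Lemma KR_sequence_refines m n : (m <= n)%N -> refines T (P n) (P m).
Proof.
move=> mn; rewrite -(subnKC mn); elim: (n - m)%N => [|k IH] A.
  by rewrite addn0 => ?; exists A.
rewrite addnS; case: seqP => _ [+ _ _ _ _] => /(_ _ _)/[apply].
move=> [A' /IH[A'' atA'' A'A''] AA'].
by exists A'' => //; exact: subset_trans AA' A'A''.
Qed.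

Lemma atoms_uniq n A A' x : atoms T (P n) A -> atoms T (P n) A' ->
  A x -> A' x -> A = A'.
Proof.
move=> [[i j] ij <-] [[i' j'] ij' <-] xij xij'; congr level.
exact: (level_uniq (KR_sequence_partition n)) xij xij'.
Qed.

Lemma KR_sequence_countable : countable (\bigcup_n atoms T (P n)).
Proof.
apply: bigcup_countable => // n _.
apply: sub_countable (card_image_le _ _) _; exact: countableP.
Qed.

Lemma KR_sequence_clopen : \bigcup_n atoms T (P n) `<=` clopen.
Proof. by move=> A [n _]; case: (KR_sequence_partition n) => _ _; apply. Qed.

(** By compactness, two disjoint closed sets do not meet the same atom of
    [P n], for [n] large. *)
Lemma KR_sequence_separates (C D : set X) :
  compact [set: X] -> closed C -> closed D -> C `&` D = set0 ->
  \forall n \near \oo, forall p x x', level_index (P n) p ->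
    level T (P n) p x -> level T (P n) p x' -> C x -> D x' -> False.
Proof.
move=> /compact_near_coveringP cptX clC clD CD0.
(* Atoms are not cut by finer partitions, so goodness persists as [n] grows and
   holds near each point. *)
pose good n x := forall p, level_index (P n) p -> level T (P n) p x ->
  level T (P n) p `<=` ~` C \/ level T (P n) p `<=` ~` D.
have : \forall n \near \oo, [set: X] `<=` good n.
  apply: cptX => x _.
  have [V [oV Vx VCD]] : exists V, [/\ open V, V x & V `<=` ~` C \/ V `<=` ~` D].
    have [Cx|nCx] := pselect (C x); last first.
      by exists (~` C); split=> //; [exact: closed_openC|left].
    exists (~` D); split; [exact: closed_openC| |by right].
    by move=> Dx; rewrite -[False]/(set0 x) -CD0.
  have [_ [_ _ _ [_ basisP] _]] := seqP.
  have [A [[m _ atA] Ax] AV] := basisP x _ (open_nbhs_nbhs (conj oV Vx)).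
  have [oA _] := KR_sequence_clopen (ex_intro2 _ _ m I atA).
  exists (A, [set n | (m <= n)%N]) => /=.
    by split; [exact: open_nbhs_nbhs|exists m].
  move=> [x' n] /= [Ax' mn] p pn px'.
  have [|A' atA' pA'] := @KR_sequence_refines _ _ mn (level T (P n) p).
    by exists p.
  have AE := atoms_uniq atA' atA (pA' _ px') Ax'; rewrite AE in pA'.
  by case: VCD => sub; [left|right];
    apply: subset_trans sub; exact: subset_trans AV.
apply: filterS => n goodn p x x' pn px px' Cx Dx'.
by have [sub|sub] := goodn x I p pn px; [exact: (sub x)|exact: (sub x')].
Qed.

End KRSequence.

(** * Estimates for non-atomic measures *)

Lemma near_forall_absz_le (I : Type) (F : set_system I) {FF : Filter F}
    (Q : int -> set I) (K : nat) : (forall k, \forall x \near F, Q k x) ->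
  \forall x \near F, forall k : int, (`|k| <= K)%N -> Q k x.
Proof.
move=> FQ; elim: K => [|K IH].
  by apply: filterS (FQ 0) => x Q0 k k0; rewrite (_ : k = 0) //; lia.
apply: filterS3 IH (FQ K.+1%:Z) (FQ (- K.+1%:Z)) => x IH Q1 Q2 k kK.
have [|k1] := leqP `|k| K; first exact: IH.
by have [->|->] : k = K.+1%:Z \/ k = - K.+1%:Z by lia.
Qed.

Section ContinuousMeasure.
Context {R : realType} {X : ptopologicalType} (mu : probability (borel X) R).

Lemma measurable_open_borel (A : set X) : open A ->
  measurable (A : set (borel X)).
Proof. by move=> oA; exact: sub_sigma_algebra. Qed.

Lemma continuous_measure_countable (A : set X) : hausdorff_space X ->
  continuous_measure mu -> countable A ->
  measurable (A : set (borel X)) /\ mu A = 0%E.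
Proof.
move=> hX mu0 cA.
have m1 (x : borel X) : measurable [set x].
  rewrite -[[set x]]setCK; apply: measurableC; apply: measurable_open_borel.
  apply: closed_openC; apply: accessible_closed_set1.
  exact: hausdorff_accessible.
have mA : measurable (A : set (borel X)) by exact: countable_measurable.
split=> //; apply/negligibleP => //; have /countable_injP[f injf] := cA.
rewrite (_ : A = \bigcup_n [set x | A x /\ f x = n]); last first.
  by apply/seteqP; split=> [x Ax|x [n _ []]//]; exists (f x).
apply: negligible_bigcup => n.
have [[x [Ax fx]]|none] := pselect (exists x, A x /\ f x = n).
  exists [set x]; split=> [||y [Ay fy]]; [exact: m1|exact: mu0|].
  exact: injf (mem_set Ay) (mem_set Ax) (etrans fy (esym fx)).
rewrite (_ : mkset _ = set0); first exact: negligible_set0.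
by apply/seteqP; split=> // x xP; apply: none; exists x.
Qed.

Lemma near_decreasing_measure_lt (A : nat -> set X) (e : R) :
  (forall n, measurable (A n : set (borel X))) -> nonincreasing_seq A ->
  measurable (\bigcap_n A n : set (borel X)) ->
  mu (\bigcap_n A n) = 0%E -> 0 < e ->
  \forall n \near \oo, (mu (A n) < e%:E)%E.
Proof.
move=> mA niA mcapA muA0 e0.
have : mu \o A @ \oo --> mu (\bigcap_n A n).
  apply: nonincreasing_cvg_mu => //.
  by rewrite (le_lt_trans (probability_le1 _ _))// ltry.
rewrite muA0 => /(_ [set y | (y < e%:E)%E]); apply.
apply: open_nbhs_nbhs; split; last by rewrite /= lte_fin.
exact: open_ereal_lt_ereal.
Qed.

End ContinuousMeasure.

(** * Density of the group when the basic set is countable *)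

Section Density.
Context {R : realType} {X : ptopologicalType} (T : homeo X) (Y : set X).
Variable P : nat -> tower_family X.
Hypotheses (hX : hausdorff_space X) (cptX : compact [set: X]).
Hypotheses (aperT : aperiodic T) (seqP : KR_sequence T Y P).

Variable S : homeo X.
Hypothesis TS : full_group T S.

(** The points that [S] moves by more than [K] steps along their orbits. *)
Definition far_set (K : nat) : set X :=
  [set x | forall k : int, (`|k| <= K)%N -> S x <> iterz T k x].

Lemma far_set_open K : open (far_set K).
Proof.
rewrite openE => x xfar.
pose Q (k : int) := [set y | (`|k| <= K)%N -> S y <> iterz T k y].
have : nbhs x [set y | forall k : int, (`|k| <= K)%N -> Q k y].
  apply: near_forall_absz_le => k; have [kK|Kk] := leqP `|k| K.
    have oneq := open_homeo_neq hX S (homeo_iterz T k).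
    have := open_nbhs_nbhs (conj oneq (xfar _ kK)).
    by apply: filterS => y Sy _.
  by apply: nearW => y kK; rewrite leqNgt Kk in kK.
by apply: filterS => y Qy k kK; exact: Qy.
Qed.

Lemma far_set_small (mu : probability (borel X) R) (e : R) : 0 < e ->
  \forall K \near \oo, (mu (far_set K) < e%:E)%E.
Proof.
have cap0 : \bigcap_K far_set K = set0.
  apply/seteqP; split=> // x xfar; have [k kE] := (full_groupP T S).1 TS x.
  exact: xfar `|k|%N I k (leqnn _) kE.
apply: near_decreasing_measure_lt; rewrite ?cap0 ?measure0//.
- by move=> K; apply: measurable_open_borel; exact: far_set_open.
- move=> m n mn; apply/subsetPset => x xfar k km.
  by apply: xfar; exact: leq_trans km mn.
Qed.

(** The points whose orbits meet the base of [P n] within time [K]. *)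
Definition near_base (K n : nat) : set X :=
  [set x | exists k : int, (`|k| <= K)%N /\ KR_base (P n) (iterz T k x)].

Lemma near_base_open K n : open (near_base K n).
Proof.
rewrite (_ : near_base K n = \bigcup_(k in [set k : int | (`|k| <= K)%N])
    iterz T k @^-1` KR_base (P n)).
  apply: bigcup_open => k _; apply: open_comp => [x _|].
    exact: iterz_continuous.
  exact: (KR_sequence_base_open seqP).
by apply/seteqP; split=> [x [k [kK xk]]|x [k kK xk]]; exists k.
Qed.

(** The same time [k] serves for all [n], because there are finitely many
    candidates and the bases decrease. *)
Lemma bigcap_near_base K :
  \bigcap_n near_base K n `<=` \bigcup_k (iterz T (- k) @` Y).
Proof.
move=> x xnear; apply: contrapT => nY.
have notY (k : int) : ~ Y (iterz T k x).
  by move=> Yk; apply: nY; exists k => //; exists (iterz T k x); rewrite ?iterzK.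
have [N _ /(_ N (leqnn N)) noN] : \forall n \near \oo, forall k : int,
    (`|k| <= K)%N -> ~ KR_base (P n) (iterz T k x).
  apply: near_forall_absz_le => k.
  have [m nm] : exists m, ~ KR_base (P m) (iterz T k x).
    apply: contrapT => all; apply: (notY k); case: seqP => _ [_ _ _ _ <-] n _.
    by apply: contrapT => nn; apply: all; exists n.
  by exists m => // n mn /(KR_sequence_base_le seqP mn).
by have [k [kK]] := xnear N I; exact: noN.
Qed.

Lemma near_base_small (mu : probability (borel X) R) (e : R) K : countable Y ->
  continuous_measure mu -> 0 < e ->
  \forall n \near \oo, (mu (near_base K n) < e%:E)%E.
Proof.
move=> cY mu0.
have cB : countable (\bigcap_n near_base K n).
  apply: sub_countable (subset_card_le (@bigcap_near_base K)) _.
  apply: bigcup_countable => [|k _]; first exact: countableP.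
  by apply: sub_countable (card_image_le _ _) _.
have [mB muB0] := continuous_measure_countable hX mu0 cB.
apply: near_decreasing_measure_lt => //.
- by move=> n; apply: measurable_open_borel; exact: near_base_open.
- move=> m n mn; apply/subsetPset => x [k [kK xk]]; exists k; split=> //.
  exact: (KR_sequence_base_le seqP) mn _ xk.
Qed.

(** For distinct [k], the sets [{x | S x = T^k x}] are disjoint and closed, and
    so are their images under [S]. *)
Lemma near_separated K : \forall n \near \oo, forall k : int, (`|k| <= K)%N ->
  forall k' : int, (`|k'| <= K)%N -> forall p x x',
  level_index (P n) p -> S x = iterz T k x -> S x' = iterz T k' x' ->
  (level T (P n) p x -> level T (P n) p x' -> k = k') /\
  (level T (P n) p (S x) -> level T (P n) p (S x') -> k = k').
Proof.
apply: near_forall_absz_le => k; apply: near_forall_absz_le => k'.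
have [->|kk'] := eqVneq k k'; first by apply: nearW.
pose E l := [set x | S x = iterz T l x].
have clE l : closed (E l).
  rewrite -[E l]setCK; apply: open_closedC.
  exact: (open_homeo_neq hX S (homeo_iterz T l)).
have disjE : E k `&` E k' = set0.
  apply/seteqP; split=> // x [Ek Ek']; move/eqP: kk'; apply.
  by apply: (aperiodic_inj aperT (x := x)); rewrite -Ek.
have clSE l : closed (hinv S @^-1` E l).
  apply: closed_comp (clE l) => x _; exact: hinv_continuous.
have disjSE : (hinv S @^-1` E k) `&` (hinv S @^-1` E k') = set0.
  by rewrite -preimage_setI disjE preimage_set0.
near=> n => p x x' pn Ek Ek'; split=> px px'; exfalso.
  by apply: (near (KR_sequence_separates seqP cptX (clE k) (clE k') disjE) n
    _ p x x').
apply: (near (KR_sequence_separates seqP cptX (clSE k) (clSE k') disjSE) n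
  _ p (S x) (S x')) => //=; by rewrite hfunK.
Unshelve. all: by end_near. Qed.

Lemma Gamma_dense_at (n : nat) (mu : 'I_n -> probability (borel X) R) (d : R) :
  countable Y -> (forall i, continuous_measure (mu i)) -> 0 < d ->
  exists2 G, Gamma T P G & tau0_ball S mu d G.
Proof.
move=> cY mu0 d0; have d2 : 0 < d / 2 by lra.
have [K _ /(_ K (leqnn K)) farK] : \forall K \near \oo, forall i,
    (mu i (far_set K) < (d / 2)%:E)%E.
  by apply: filter_forall => i; exact: far_set_small.
have : \forall N \near \oo, forall i, (mu i (near_base K N) < (d / 2)%:E)%E.
  by apply: filter_forall => i; exact: near_base_small.
move=> /(filterI (near_separated K))[N _ /(_ N (leqnn N))[sepN baseN]].
have [s sP] : exists s, forall x,
    tower_homeo (KR_sequence_partition seqP N) s x <> S x ->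
    far_set K x \/ near_base K N x.
  apply: tower_homeo_approx => p k k' x x' pN Kk Kk' px px' Ek Ek';
    by have [] := sepN k Kk k' Kk' p x x' pN Ek Ek'; auto.
exists (tower_homeo (KR_sequence_partition seqP N) s) => [|i].
  exact: tower_homeo_Gamma.
apply: (@le_lt_trans _ _ (mu i (far_set K `|` near_base K N))).
  apply: le_measure.
  - by apply/mem_set; exact: measurable_homeo_neq.
  - by apply/mem_set; apply: measurableU; apply: measurable_open_borel;
      [exact: far_set_open|exact: near_base_open].
  - by move=> x; exact: sP.
apply: (@le_lt_trans _ _ (mu i (far_set K) + mu i (near_base K N))%E).
  by apply: measureU2; apply: measurable_open_borel;
    [exact: far_set_open|exact: near_base_open].
by rewrite [d]splitr EFinD; apply: lteD.
Qed.

End Density.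

(** * The inverse of [T] and the basic set *)

(** A point of [Y] is at height [0] in every [P n], so [G] moves it by a
    nonnegative power of [T]. *)
Lemma Gamma_neq_inv (X : topologicalType) (T : homeo X) (Y : set X)
    (P : nat -> tower_family X) (G : homeo X) y :
  aperiodic T -> KR_sequence T Y P -> Gamma T P G -> Y y ->
  G y <> homeo_inv T y.
Proof.
move=> aperT seqP [_ [n Gn]] Yy Gy.
have [i _ iy] : KR_base (P n) y.
  by case: seqP => _ [_ _ _ _ capY]; move: Yy; rewrite -capY; exact.
have [h0 _ _] := KR_sequence_partition seqP n.
have [l [l0 Gl]] := Gn i 0%N (h0 i).
have lE : l = -1.
  apply: (aperiodic_inj aperT (x := y)); rewrite -Gl ?Gy//.
  by exists y.
by move: l0; rewrite lE.
Qed.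

Theorem theorem3p4 (R : realType) (X : pseudoPMetricType R) (T : homeo X)
    (Y : set X) (P : nat -> tower_family X)
    (cantorX : cantor_like X) (aperT : aperiodic T) (basicY : basic_set T Y)
    (seqP : KR_sequence T Y P) :
  full_group T `<=` closure (Gamma T P : set (tau0 R X)) <-> countable Y.
Proof.
have [_ cptX hX _] := cantorX; split=> [dense|cY S TS U].
  apply: contrapT => ucY; have [clY _ _] := basicY.
  have [_ [_ _ _ basisP _]] := seqP.
  have [mu [mu0 muY]] := exists_continuous_measure R hX cptX
    (KR_sequence_countable T P) basisP (KR_sequence_clopen seqP) clY ucY.
  (* For this measure the ball of radius 1 around the inverse of [T] contains
     no element of [Gamma]. *)
  pose B : set (tau0 R X) := tau0_ball (homeo_inv T) (fun _ : 'I_1 => mu) 1.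
  have baseB : tau0_base R X B.
    by exists (homeo_inv T), 1%N, (fun=> mu), 1; split.
  have BT : B (homeo_inv T).
    by move=> i; rewrite (_ : mkset _ = set0) ?measure0 ?lte_fin//;
      apply/seteqP; split.
  have oB := (tau0_basis R hX).1 _ baseB.
  have [G [GG /(_ ord0)]] := dense _ (@full_group_inv _ T) _
    (open_nbhs_nbhs (conj oB BT)).
  apply/negP; rewrite -leNgt -muY; apply: le_measure.
  - apply/mem_set; rewrite -[Y]setCK; apply: measurableC.
    apply: measurable_open_borel; exact: closed_openC.
  - by apply/mem_set; exact: measurable_homeo_neq.
  - by move=> y; exact: Gamma_neq_inv GG.
move=> /(tau0_basis R hX).2[B [baseB BS] BU].
have [S0 [n [mu [e [mu0 e0 BE]]]]] := baseB.
rewrite BE in BS; have [d d0 sub] := tau0_ball_center hX BS.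
have [G GG Gd] := Gamma_dense_at hX cptX aperT seqP TS cY mu0 d0.
by exists G; split=> //; apply: BU; rewrite BE; exact: sub.
Qed.
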